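(* Consider the time-delay system $$\dot x(t)=Ax(t)+f\big(x(t),x(t-\tau(t)),u(t),u(t-\tau(t))\big),\quad t\ge 0,\qquad y(t)=Cx(t),$$ with a continuous initial function for $x$, where $x(t)\in\mathbb{R}^n$, $u(t)\in\mathbb{R}^m$, $y(t)\in\mathbb{R}$, and $A$, $C$, $f$ are as described in the context. Suppose that Assumptions A1, H1 and H2 of the context hold, with functions $\gamma_1,\gamma_2,\gamma_3$, compact set $K\subset\mathbb{R}^n$ and delay bound $\tau^*>0$. Let $L=[l_1,\dots,l_n]^T\in\mathbb{R}^n$ be such that $A_L:=A+LC$ is Hurwitz, and let $P$ be the symmetric positive definite solution of $A_L^TP+PA_L=-I$. Suppose that there exists $\varepsilon>0$ such that $$\frac{\lambda_{\min}(P)}{\varepsilon\|P\|}-2n\gamma_1(\varepsilon)\|P\|-\frac54-n^2\gamma_2^2(\varepsilon)\|P\|^2>0.$$ For such $\varepsilon$, let $L(\varepsilon)=\left[\frac{l_1}{\varepsilon},\dots,\frac{l_n}{\varepsilon^n}\right]^T$ and consider the observer $$\dot{\hat x}(t)=A\hat x(t)+f\big(\hat x(t),\hat x(t-\tau^* ),u(t),u(t-\tau^* )\big)+L(\varepsilon)\big(C\hat x(t)-y(t)\big),\qquad \hat y(t)=C\hat x(t).$$ Then the dynamics of the observation error $e=\hat x-x$, $$\dot e(t)=(A+L(\varepsilon)C)e(t)+f\big(\hat x(t),\hat x(t-\tau^* ),u(t),u(t-\tau^* )\big)-f\big(x(t),x(t-\tau(t)),u(t),u(t-\tau(t))\big),$$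 are globally (on $K$) practically exponentially stable. That is, there exist $r>0$, $\lambda_1>0$ and $\lambda_2>0$ such that, for every solution $x$ of the system that stays in $K$ as in H1, every continuous initial function of $\hat x$ on $[-\tau^*,0]$, and all $t\ge 0$, $$\|e(t)\|\le r+\lambda_1\Big(\max_{s\in[-\tau^*,0]}\|e(s)\|\Big)e^{-\lambda_2 t}.$$
   Context: $\|\cdot\|$ is the Euclidean norm on vectors and the induced norm on matrices; $\lambda_{\min}(P)$ is the smallest eigenvalue of $P$. Initial functions are continuous maps $[-\tau^*,0]\to\mathbb{R}^n$. The matrix $A\in\mathbb{R}^{n\times n}$ has entries $A_{i,i+1}=1$ for $1\le i\le n-1$ and all other entries $0$; $C=[1,0,\dots,0]\in\mathbb{R}^{1\times n}$. The map $f=[f_1,\dots,f_n]^T$ has components $f_i:\mathbb{R}^n\times\mathbb{R}^n\times\mathbb{R}^m\times\mathbb{R}^m\to\mathbb{R}$ that are smooth with $f_i(0,0,0,0)=0$. Assumption A1: there exist functions $\gamma_1(\varepsilon)>0$, $\gamma_2(\varepsilon)>0$, $\gamma_3(\varepsilon)>0$ such that for every $\varepsilon>0$ and all $x,y,\bar x,\bar y\in\mathbb{R}^n$, $u,v,\bar v\in\mathbb{R}^m$ (here $v,\bar v$ stand for values of the delayed input), $$\sum_{i=1}^n\varepsilon^{i-1}|f_i(x,\bar x,u,v)-f_i(y,\bar y,u,v)|\le\gamma_1(\varepsilon)\sum_{i=1}^n\varepsilon^{i-1}|x_i-y_i|+\gamma_2(\varepsilon)\sum_{i=1}^n\varepsilon^{i-1}|\bar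 x_i-\bar y_i|,$$ $$\sum_{i=1}^n\varepsilon^{i-1}|f_i(x,\bar x,u,v)-f_i(x,\bar y,u,\bar v)|\le\gamma_2(\varepsilon)\sum_{i=1}^n\varepsilon^{i-1}|\bar x_i-\bar y_i|+\gamma_3(\varepsilon)\sum_{i=1}^n\varepsilon^{i-1}\|v-\bar v\|.$$ Assumption H1: the state and the input are bounded, namely $x(t)\in K$ for all $t\ge-\tau^*$, where $K\subset\mathbb{R}^n$ is a compact set, and $u$ is bounded on $[-\tau^*,\infty)$. Assumption H2: the (unknown) time-varying delay $\tau(t)$ is continuously differentiable and (i) there is $\tau^*>0$ such that $0\le\tau(t)\le\tau^*$ for all $t$; (ii) there is $\beta>0$ such that $\dot\tau(t)\le 1-\beta$ for all $t$. The input $u$ is a given function on $[-\tau^*,\infty)$ with values in $\mathbb{R}^m$, regular enough (e.g. continuous) for the solutions to be defined. The initial time is $t_0=0$. *)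

(* Defs.v *)
From mathcomp Require Import all_boot all_order all_algebra.
From mathcomp Require Import all_classical all_reals all_analysis.
From mathcomp.real_closed Require Import complex.

Set Implicit Arguments.
Unset Strict Implicit.
Unset Printing Implicit Defensive.

Import Order.TTheory GRing.Theory Num.Theory.
Import numFieldNormedType.Exports.

Local Open Scope classical_set_scope.
Local Open Scope ring_scope.

(* The library norm `|x| on matrices is the maximum norm, hence these two. *)
Definition enorm (R : realType) (k : nat) (x : 'cV[R]_k) : R :=
  Num.sqrt (\sum_(i < k) x i 0 ^+ 2).

Definition opnorm (R : realType) (p q : nat) (M : 'M[R]_(p, q)) : R :=
  sup [set enorm (M *m x) | x in [set x : 'cV[R]_q | enorm x <= 1]].

(* Used for symmetric matrices of positive size only, whose set of real
   eigenvalues is finite and nonempty, so that the infimum is a minimum. *)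
Definition lambda_min (R : realType) (n : nat) (P : 'M[R]_n) : R :=
  inf [set a : R | eigenvalue P a].

Definition hurwitz (R : realType) (n : nat) (M : 'M[R]_n) : Prop :=
  forall z : R[i],
    eigenvalue (map_mx (real_complex R) M) z -> complex.Re z < 0.

Definition sym_posdef (R : realType) (n : nat) (P : 'M[R]_n) : Prop :=
  P^T = P /\ forall x : 'cV[R]_n, x != 0 -> 0 < (x^T *m P *m x) 0 0.

(* All iterated directional derivatives exist and are Frechet differentiable
   (in particular continuous); in finite dimension this is C^infinity. *)
Definition smooth (R : realType) (V : normedModType R) (f : V -> R^o) : Prop :=
  forall (vs : seq V) (x : V),
    differentiable (foldr (fun v (g : V -> R^o) y => 'D_v g y) f vs) x.

(* Derivative relative to D: two-sided in the interior, one-sided at an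
   endpoint such as the initial time. *)
Definition is_derive_within (R : realType) (V : normedModType R) (D : set R)
    (x : R -> V) (t : R) (v : V) : Prop :=
  (fun s => (s - t)^-1 *: (x s - x t)) @ within D t^' --> v.

(* x is defined on R, but only its values on [-taus, +oo[ matter. *)
Definition dde_solution (R : realType) (n : nat) (taus : R)
    (rhs : R -> 'cV[R]_n) (x : R -> 'cV[R]_n) : Prop :=
  {within `[- taus, +oo[, continuous x} /\
  forall t, 0 <= t -> is_derive_within `[0, +oo[ x t (rhs t).

Definition shiftA (R : realType) (n : nat) : 'M[R]_n :=
  \matrix_(i, j) (i.+1 == j)%:R.

Definition outC (R : realType) (n : nat) : 'rV[R]_n :=
  \row_j ((j : nat) == 0%N)%:R.

(* Indices start at 0: the i-th entry is l_(i+1) / eps^(i+1). *)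
Definition gainL (R : realType) (n : nat) (L : 'cV[R]_n) (eps : R) : 'cV[R]_n :=
  \col_i (L i 0 / eps ^+ i.+1).

Definition system_solution (R : realType) (n m : nat)
    (f : 'cV[R]_n -> 'cV[R]_n -> 'cV[R]_m -> 'cV[R]_m -> 'cV[R]_n)
    (taus : R) (tau : R -> R) (u : R -> 'cV[R]_m) (x : R -> 'cV[R]_n) : Prop :=
  dde_solution taus
    (fun t => shiftA R n *m x t + f (x t) (x (t - tau t)) (u t) (u (t - tau t)))
    x.

Definition observer_solution (R : realType) (n m : nat)
    (f : 'cV[R]_n -> 'cV[R]_n -> 'cV[R]_m -> 'cV[R]_m -> 'cV[R]_n)
    (taus : R) (Leps : 'cV[R]_n) (u : R -> 'cV[R]_m) (y : R -> 'M[R]_1)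
    (xhat : R -> 'cV[R]_n) : Prop :=
  dde_solution taus
    (fun t => shiftA R n *m xhat t
              + f (xhat t) (xhat (t - taus)) (u t) (u (t - taus))
              + Leps *m (outC R n *m xhat t - y t))
    xhat.

Definition assumption_A1 (R : realType) (n m : nat)
    (f : 'cV[R]_n -> 'cV[R]_n -> 'cV[R]_m -> 'cV[R]_m -> 'cV[R]_n)
    (gamma1 gamma2 gamma3 : R -> R) : Prop :=
  forall eps : R, 0 < eps ->
    [/\ 0 < gamma1 eps, 0 < gamma2 eps & 0 < gamma3 eps] /\
    forall (x y xb yb : 'cV[R]_n) (u v vb : 'cV[R]_m),
      \sum_(i < n) eps ^+ i * `|f x xb u v i 0 - f y yb u v i 0|
        <= gamma1 eps * (\sum_(i < n) eps ^+ i * `|x i 0 - y i 0|)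
           + gamma2 eps * (\sum_(i < n) eps ^+ i * `|xb i 0 - yb i 0|) /\
      \sum_(i < n) eps ^+ i * `|f x xb u v i 0 - f x yb u vb i 0|
        <= gamma2 eps * (\sum_(i < n) eps ^+ i * `|xb i 0 - yb i 0|)
           + gamma3 eps * (\sum_(i < n) eps ^+ i * enorm (v - vb)).

Definition assumption_H2 (R : realType) (taus : R) (tau : R -> R) : Prop :=
  [/\ 0 < taus,
      forall t, 0 <= t -> 0 <= tau t <= taus
    & exists (dtau : R -> R) (beta : R),
      [/\ 0 < beta,
          {within `[0, +oo[, continuous dtau},
          forall t, 0 <= t ->
            is_derive_within (V := R^o) `[0, +oo[ tau t (dtau t)
        & forall t, 0 <= t -> dtau t <= 1 - beta]].

(* Main.v *)
Require Import Defs.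
From mathcomp Require Import all_boot all_order all_algebra.
From mathcomp Require Import all_classical all_reals all_analysis.
From mathcomp Require Import ring lra.

(** The error is rescaled to [z i = eps ^+ i * e i].  This conjugates the
    high-gain matrix [A + L(eps) C] to [eps^-1 *: (A + L C)], so [P] is a
    Lyapunov matrix for the linear part, and it turns the weighted Lipschitz
    inequalities of the assumption on [f] into bounds on the norm of [z].

    Along the error, [V = z^T P z] therefore satisfies
      [V' <= - eps^-1 |z|^2 + 2 |z| |P| (n g1 |z| + n g2 |z(t - T)| + M0)]
    with [T] the delay bound.  The constant [M0] is the price of using [T] in
    place of the true delay; it is finite because the state and the input are
    bounded, and it produces the residual radius [r].  Young's inequality,
    applied to the last two products, gives
      [V' <= - a |z|^2 + |z(t - T)|^2 + M],
    and the gain condition yields [a > 1], because the quotient of the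
    smallest eigenvalue of [P] by its norm is at most 1
    ([lambda_min_le_opnorm], [gain_quotient_le]).

    Since [a > 1], the instantaneous damping beats the delayed term, with room
    left for an exponential weight.  With [G] a primitive of
    [expR (l * s) * |z s|^2], the Lyapunov-Krasovskii functional
      [expR (l * t) * V t + c * (G t - G (t - T)) - M / l * expR (l * t)]
    is nonincreasing for a suitable [c > 1] and a small [l > 0]
    ([delay_gronwall]).  A Razumikhin argument would not do: comparing
    [|z(t - T)|] with [|z t|] through [V] costs the condition number of [P].
    Coercivity of [P] ([posdef_coercive]) and a square root turn the decay of
    [V] into that of the norm of the error. *)

Set Implicit Arguments.
Unset Strict Implicit.
Unset Printing Implicit Defensive.

Import Order.TTheory GRing.Theory Num.Theory.
Import numFieldNormedType.Exports.

Local Open Scope classical_set_scope.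
Local Open Scope ring_scope.

(** * The Euclidean norm, the operator norm and definite forms *)

Section Euclid.
Context {R : realType}.

Definition dot k (x y : 'cV[R]_k) : R := (x^T *m y) 0 0.

Lemma dotE k (x y : 'cV[R]_k) : dot x y = \sum_i x i 0 * y i 0.
Proof. by rewrite /dot mxE; apply: eq_bigr => i _; rewrite mxE. Qed.

Lemma dotC k (x y : 'cV[R]_k) : dot x y = dot y x.
Proof. by rewrite !dotE; apply: eq_bigr => i _; rewrite mulrC. Qed.

Lemma dotDl k (x y z : 'cV[R]_k) : dot (x + y) z = dot x z + dot y z.
Proof. by rewrite /dot linearD mulmxDl mxE. Qed.

Lemma dotDr k (x y z : 'cV[R]_k) : dot z (x + y) = dot z x + dot z y.
Proof. by rewrite /dot mulmxDr mxE. Qed.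

Lemma dotZl k a (x y : 'cV[R]_k) : dot (a *: x) y = a * dot x y.
Proof. by rewrite /dot linearZ -scalemxAl mxE. Qed.

Lemma dotZr k a (x y : 'cV[R]_k) : dot x (a *: y) = a * dot x y.
Proof. by rewrite /dot -scalemxAr mxE. Qed.

Lemma dot_mulmxr p q (M : 'M[R]_(p, q)) x y : dot x (M *m y) = dot (M^T *m x) y.
Proof. by rewrite /dot trmx_mul trmxK mulmxA. Qed.

Lemma dot_ge0 k (x : 'cV[R]_k) : 0 <= dot x x.
Proof. by rewrite dotE sumr_ge0 // => i _; rewrite -expr2 sqr_ge0. Qed.

Lemma enormE k (x : 'cV[R]_k) : enorm x = Num.sqrt (dot x x).
Proof.
by rewrite /enorm dotE; congr Num.sqrt; apply: eq_bigr => i _; rewrite expr2.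
Qed.

Lemma enorm_ge0 k (x : 'cV[R]_k) : 0 <= enorm x.
Proof. exact: sqrtr_ge0. Qed.

Lemma enorm_sqr k (x : 'cV[R]_k) : enorm x ^+ 2 = dot x x.
Proof. by rewrite enormE sqr_sqrtr // dot_ge0. Qed.

Lemma enorm0 k : enorm (0 : 'cV[R]_k) = 0.
Proof. by rewrite enormE /dot mulmx0 mxE sqrtr0. Qed.

Lemma enormZ k a (x : 'cV[R]_k) : enorm (a *: x) = `|a| * enorm x.
Proof.
by rewrite !enormE dotZl dotZr mulrA -expr2 sqrtrM ?sqr_ge0 // sqrtr_sqr.
Qed.

Lemma enorm_eq0 k (x : 'cV[R]_k) : (enorm x == 0) = (x == 0).
Proof.
apply/idP/eqP => [x0|->]; last by rewrite enorm0.
have : enorm x ^+ 2 == 0 by rewrite sqrf_eq0.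
rewrite enorm_sqr dotE psumr_eq0 => [/allP h|i _]; last first.
  by rewrite -expr2 sqr_ge0.
apply/matrixP => i j; rewrite ord1 mxE; apply/eqP.
by have := h i (mem_index_enum _); rewrite /= -expr2 sqrf_eq0.
Qed.

(** For [c > 0] the minimum of the polynomial, at [- b / c], is
    [(a * c - b ^+ 2) / c]; for [c = 0] an affine function bounded below is
    constant. *)
Lemma discriminant_le (a b c : R) : 0 <= c ->
  (forall t, 0 <= a + 2 * t * b + t ^+ 2 * c) -> b ^+ 2 <= a * c.
Proof.
rewrite le_eqVlt => /predU1P[<-|c_gt0] h.
  rewrite mulr0; have [->|b0] := eqVneq b 0; first by rewrite expr0n.
  have := h (- (a + 1) / (2 * b)).
  have -> : a + 2 * (- (a + 1) / (2 * b)) * b + (- (a + 1) / (2 * b)) ^+ 2 * 0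
            = -1 by field.
  by rewrite lerNr oppr0 ler10.
have := h (- b / c).
have -> : a + 2 * (- b / c) * b + (- b / c) ^+ 2 * c = (a * c - b ^+ 2) / c.
  by field; rewrite gt_eqF.
by rewrite pmulr_lge0 ?invr_gt0 // subr_ge0.
Qed.

(** The form is evaluated along the line [x + t *: y]. *)
Lemma psd_cauchy_schwarz k (Q : 'M[R]_k) (x y : 'cV[R]_k) :
  Q^T = Q -> (forall z, 0 <= dot z (Q *m z)) ->
  dot x (Q *m y) ^+ 2 <= dot x (Q *m x) * dot y (Q *m y).
Proof.
move=> Qsym Qpsd; apply: discriminant_le => // t.
have := Qpsd (x + t *: y).
rewrite mulmxDr -scalemxAr !dotDl !dotDr !dotZl !dotZr.
rewrite (_ : dot y (Q *m x) = dot x (Q *m y)); last first.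
  by rewrite dotC [RHS]dot_mulmxr Qsym.
by congr (_ <= _); ring.
Qed.

Lemma dot_le_enorm k (x y : 'cV[R]_k) : dot x y <= enorm x * enorm y.
Proof.
rewrite -[leRHS]ger0_norm ?mulr_ge0 ?enorm_ge0 //.
apply: le_trans (ler_norm _) _.
rewrite -ler_sqr ?qualifE /= ?normr_ge0 ?mulr_ge0 ?enorm_ge0 //.
rewrite !real_normK ?num_real // exprMn !enorm_sqr.
have I_psd (z : 'cV_k) : 0 <= dot z (1%:M *m z) by rewrite mul1mx dot_ge0.
by have := psd_cauchy_schwarz x y (trmx1 _ _) I_psd; rewrite !mul1mx.
Qed.

Lemma enormD k (x y : 'cV[R]_k) : enorm (x + y) <= enorm x + enorm y.
Proof.
rewrite -ler_sqr ?qualifE /= ?addr_ge0 ?enorm_ge0 //.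
rewrite sqrrD !enorm_sqr !dotDl !dotDr (dotC y x).
have := dot_le_enorm x y; lra.
Qed.

Lemma enormN k (x : 'cV[R]_k) : enorm (- x) = enorm x.
Proof. by rewrite -scaleN1r enormZ normrN1 mul1r. Qed.

Lemma coord_le_enorm k (x : 'cV[R]_k) i : `|x i 0| <= enorm x.
Proof.
rewrite -ler_sqr ?qualifE /= ?enorm_ge0 // real_normK ?num_real // enorm_sqr dotE.
rewrite (bigD1 i) //= -expr2 lerDl sumr_ge0 // => j _.
by rewrite -expr2 sqr_ge0.
Qed.

Lemma sum_coord_le_enorm k (x : 'cV[R]_k) :
  \sum_i `|x i 0| <= k%:R * enorm x.
Proof.
apply: le_trans (ler_sum _ (fun i _ => coord_le_enorm x i)) _.
by rewrite sumr_const card_ord mulr_natl.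
Qed.

Lemma enorm_le_sum_coord k (x : 'cV[R]_k) : enorm x <= \sum_i `|x i 0|.
Proof.
have s0 : 0 <= \sum_i `|x i 0| by apply: sumr_ge0.
rewrite -ler_sqr ?qualifE /= ?enorm_ge0 // enorm_sqr dotE expr2 mulr_suml.
apply: ler_sum => i _; apply: le_trans (ler_norm _) _.
rewrite normrM ler_wpM2l // (bigD1 i) //= lerDl; exact: sumr_ge0.
Qed.

Lemma enorm_mulmx_le k p (M : 'M[R]_(p, k)) (x : 'cV[R]_k) :
  enorm (M *m x) <= (\sum_i \sum_j `|M i j|) * enorm x.
Proof.
apply: le_trans (enorm_le_sum_coord _) _; rewrite mulr_suml.
apply: ler_sum => i _; rewrite mxE mulr_suml.
apply: le_trans (ler_norm_sum _ _ _) _; apply: ler_sum => j _.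
by rewrite normrM ler_wpM2l // coord_le_enorm.
Qed.

Lemma opnorm_has_ubound k p (M : 'M[R]_(p, k)) :
  has_ubound [set enorm (M *m x) | x in [set x : 'cV[R]_k | enorm x <= 1]].
Proof.
exists (\sum_i \sum_j `|M i j|) => _ [y /= y1 <-].
apply: le_trans (enorm_mulmx_le _ _) _; rewrite -[leRHS]mulr1.
by rewrite ler_wpM2l //; do 2!apply: sumr_ge0 => ? _.
Qed.

Lemma enorm_le_opnorm k p (M : 'M[R]_(p, k)) (x : 'cV[R]_k) :
  enorm (M *m x) <= opnorm M * enorm x.
Proof.
have [->|x0] := eqVneq x 0; first by rewrite mulmx0 !enorm0 mulr0.
have ex : 0 < enorm x by rewrite lt_neqAle eq_sym enorm_eq0 x0 enorm_ge0.
rewrite -ler_pdivrMr // mulrC -{1}(gtr0_norm ex) -normfV -enormZ scalemxAr.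
apply: ub_le_sup; first exact: opnorm_has_ubound.
exists ((enorm x)^-1 *: x) => //=.
by rewrite enormZ normfV (gtr0_norm ex) mulVf // gt_eqF.
Qed.

Lemma opnorm_ge0 k p (M : 'M[R]_(p, k)) : 0 <= opnorm M.
Proof.
apply: ub_le_sup; first exact: opnorm_has_ubound.
by exists 0; rewrite /= ?mulmx0 enorm0.
Qed.

(** A real eigenvalue is at most the norm; if there is none, or no lower bound,
    the infimum is 0 by convention, and the norm is nonnegative. *)
Lemma lambda_min_le_opnorm k (Q : 'M[R]_k) :
  Q^T = Q -> lambda_min Q <= opnorm Q.
Proof.
move=> Qsym; rewrite /lambda_min.
have [[[a aQ] lbQ]|/inf_out ->] := pselect (has_inf [set a : R | eigenvalue Q a]).
  apply: le_trans (ge_inf lbQ aQ) _.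
  have /eigenvalueP[v vQ v0] := aQ.
  have v0' : v^T != 0 by rewrite trmx_eq0.
  have ev : 0 < enorm v^T by rewrite lt_neqAle eq_sym enorm_eq0 v0' enorm_ge0.
  rewrite -(ler_pM2r ev) (le_trans _ (enorm_le_opnorm Q v^T)) //.
  rewrite -Qsym -trmx_mul vQ linearZ /= enormZ.
  by rewrite ler_wpM2r ?enorm_ge0 // ler_norm.
exact: opnorm_ge0.
Qed.

(** Cauchy-Schwarz for the form of [Q], applied to [x] and [Q^-1 x], gives
    [|x|^4 <= (x^T Q x) (x^T Q^-1 x)], whose last factor is at most
    [|Q^-1| |x|^2]; so [|Q^-1|^-1] is a coercivity constant, without recourse
    to the spectral theorem or to the compactness of the sphere. *)
Lemma posdef_coercive k (Q : 'M[R]_k) : sym_posdef Q ->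
  exists2 c, 0 < c & forall x, c * enorm x ^+ 2 <= dot x (Q *m x).
Proof.
move=> [Qsym Qpos].
have Qpsd z : 0 <= dot z (Q *m z).
  have [->|z0] := eqVneq z 0; first by rewrite /dot !mulmx0 mxE.
  by rewrite /dot mulmxA ltW // Qpos.
have Qu : Q \in unitmx.
  rewrite -row_free_unit; apply/row_freeP; apply/row_freeP.
  rewrite -kermx_eq0; apply/rowV0P => v /sub_kermxP vQ.
  apply/eqP/negPn/negP => v0.
  by have := Qpos v^T; rewrite trmx_eq0 trmxK vQ mul0mx mxE ltxx => /(_ v0).
(* Adding 1 keeps [p] positive in dimension 0 too. *)
pose p := opnorm (invmx Q) + 1.
have p0 : 0 < p by rewrite ltr_wpDl ?opnorm_ge0.
exists p^-1; first by rewrite invr_gt0.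
move=> x; rewrite mulrC ler_pdivrMr //.
have [->|x0] := eqVneq x 0; first by rewrite enorm0 expr0n mulr_ge0 // ltW.
have ex : 0 < enorm x ^+ 2.
  by rewrite exprn_gt0 // lt_neqAle eq_sym enorm_eq0 x0 enorm_ge0.
rewrite -(ler_pM2r ex).
have := psd_cauchy_schwarz x (invmx Q *m x) Qsym Qpsd.
rewrite mulmxA mulmxV // mul1mx -enorm_sqr -expr2 => /le_trans; apply.
rewrite -mulrA ler_wpM2l //.
apply: le_trans (dot_le_enorm _ _) _.
rewrite [enorm x ^+ 2]expr2 mulrA ler_wpM2r ?enorm_ge0 //.
apply: le_trans (enorm_le_opnorm _ _) _.
by rewrite ler_wpM2r ?enorm_ge0 // lerDl.
Qed.

End Euclid.

(** * Differentiable curves of vectors *)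

Section Curves.
Context {R : realType}.

(** A positive time is interior to the half-line, where the restriction of the
    difference quotient to the half-line is void. *)
Lemma is_derive_within_coord n (x : R -> 'cV[R]_n) t v i : 0 < t ->
  is_derive_within `[0, +oo[ x t v ->
  is_derive t (1 : R) (fun s => x s i 0) (v i 0).
Proof.
move=> t0 xv.
suff xi : (fun h => h^-1 *: (x (h + t) i 0 - x t i 0)) @ 0^' --> v i 0.
  have e : (fun h : R =>
      h^-1 *: (((fun s => x s i 0) \o shift t) (h *: 1) - x t i 0))
      = (fun h => h^-1 *: (x (h + t) i 0 - x t i 0)).
    by apply/funext => h /=; rewrite [h *: 1]mulr1.
  apply: DeriveDef; first by apply/cvg_ex; exists (v i 0); rewrite /= e.
  by rewrite /derive /= e; apply: cvg_lim.
have shift_cvg : (fun h : R => h + t) @ 0^' --> within `[0, +oo[ t^'.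
  move=> U /= tU.
  have [r r0 rU] : nbhs_ball t
      [set y | y != t -> `[0, +oo[%classic y -> U y].
    by apply/nbhs_ballP; exact: tU.
  have rt0 : 0 < Num.min r t by rewrite lt_min r0.
  apply/nbhs_ballP; exists (Num.min r t) => //= h.
  rewrite -ball_normE /= sub0r normrN lt_min => /andP[hr ht] h0.
  apply: rU.
  - by rewrite -ball_normE /= opprD addrCA subrr addr0 normrN.
  - by rewrite -subr_eq0 addrK.
  - rewrite /= in_itv/= andbT.
    by move: ht; rewrite ltr_norml => /andP[? _]; lra.
have := cvg_comp _ _ shift_cvg xv.
move=> /(cvg_comp _ _) /(_ (@coord_continuous R n 1 i 0 v)).
apply: cvg_trans; apply: near_eq_cvg; near=> h => /=.
by rewrite addrK !mxE.
Unshelve. all: by end_near. Qed.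

Lemma within_continuous_coord n (A : set R) (x : R -> 'cV[R]_n) i :
  {within A, continuous x} -> {within A, continuous (fun s => x s i 0)}.
Proof.
move=> xc s; apply: (@cvg_comp _ _ _ x (fun M : 'cV[R]_n => M i 0)).
  exact: xc.
exact: coord_continuous.
Qed.

Lemma within_continuous_coordB n (A : set R) (x y : R -> 'cV[R]_n) i :
  {within A, continuous x} -> {within A, continuous y} ->
  {within A, continuous (fun s => (x s - y s) i 0)}.
Proof.
move=> xc yc.
have -> : (fun s : R => (x s - y s) i 0) =
    (fun s : R => x s i 0) - (fun s : R => y s i 0).
  by apply/funext => s; rewrite !mxE.
exact: (within_continuousB (within_continuous_coord (i := i) xc)
          (within_continuous_coord (i := i) yc)).
Qed.

Lemma within_continuous_dot n (A : set R) (x y : R -> 'cV[R]_n) :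
  (forall i, {within A, continuous (fun s => x s i 0)}) ->
  (forall i, {within A, continuous (fun s => y s i 0)}) ->
  {within A, continuous (fun s => dot (x s) (y s))}.
Proof.
move=> xc yc.
rewrite (_ : (fun s => dot (x s) (y s)) =
  \sum_i ((fun s => x s i 0) * (fun s => y s i 0))); last first.
  by apply/funext => s; rewrite dotE fct_sumE.
elim/big_ind: _ => [|f g fc gc|i _].
- by apply: continuous_subspaceT => s; exact: cvg_cst.
- exact: within_continuousD fc gc.
- by move=> s; apply: continuousM; [exact: xc|exact: yc].
Qed.

Lemma within_continuous_mulmx n (A : set R) (Q : 'M[R]_n) (x : R -> 'cV[R]_n) :
  (forall i, {within A, continuous (fun s => x s i 0)}) ->
  forall i, {within A, continuous (fun s => (Q *m x s) i 0)}.
Proof.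
move=> xc i.
have e s : (Q *m x s) i 0 = dot (\col_j Q i j) (x s).
  by rewrite dotE mxE; apply: eq_bigr => j _; rewrite mxE.
under eq_fun do rewrite e.
apply: (@within_continuous_dot _ _ (fun=> _)) => // j.
by apply: continuous_subspaceT => s; exact: cvg_cst.
Qed.

(** The supremum of an unbounded set is 0, so the bound rests on compactness
    of the segment. *)
Lemma enorm_le_sup_segment n (x : R -> 'cV[R]_n) (a b s : R) :
  (forall i, {within `[a, b], continuous (fun r => x r i 0)}) ->
  a <= s <= b -> enorm (x s) <= sup [set enorm (x r) | r in `[a, b]].
Proof.
move=> xc sab; apply: ub_le_sup; last by exists s; rewrite //= in_itv.
have ab : a <= b by have /andP[as_ sb] := sab; exact: le_trans as_ sb.
have [r _ rmax] := EVT_max ab (within_continuous_dot xc xc).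
exists (enorm (x r)) => _ [q /= qab <-].
by rewrite !enormE ler_wsqrtr // rmax.
Qed.

Lemma is_derive_fun_sum n (F : 'I_n -> R -> R) (t : R) (d : 'I_n -> R) :
  (forall i, is_derive t (1 : R) (F i) (d i)) ->
  is_derive t (1 : R) (fun s => \sum_i F i s) (\sum_i d i).
Proof.
move=> dF; have := is_derive_sum dF.
by congr (is_derive _ _ _ _); apply/funext => s; rewrite fct_sumE.
Qed.

Lemma is_derive_quadratic n (Q : 'M[R]_n) (x : R -> 'cV[R]_n) (t : R)
    (w : 'cV[R]_n) :
  (forall i, is_derive t (1 : R) (fun s => x s i 0) (w i 0)) ->
  is_derive t (1 : R) (fun s => dot (x s) (Q *m x s))
    (dot w (Q *m x t) + dot (x t) (Q *m w)).
Proof.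
move=> dx.
have dQ i : is_derive t (1 : R) (fun s => (Q *m x s) i 0) ((Q *m w) i 0).
  under eq_fun do rewrite mxE.
  by rewrite mxE; apply: is_derive_fun_sum => j; exact: is_deriveZ.
under eq_fun do rewrite dotE.
rewrite !dotE addrC -big_split /=.
apply: is_derive_fun_sum => i; rewrite [w i 0 * _]mulrC.
exact: is_deriveM.
Qed.

Lemma bounded_coord (T : Type) n (A : set T) (F : T -> 'cV[R]_n) :
  bounded_near F (globally A) ->
  exists B, forall t, A t -> forall i, `|F t i 0| <= B.
Proof.
move=> /pinfty_ex_gt0 [B _ FB]; exists B => t At i; apply: le_trans (FB t At).
rewrite /Num.norm/= mx_normrE.
exact: (le_bigmax _ (fun ij => `|F t ij.1 ij.2|) (i, 0)).
Qed.

End Curves.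

(** * An exponential estimate for delay differential inequalities *)

Section Delay.
Context {R : realType}.

Lemma derive_le0_le (f df : R -> R) (a b : R) : a <= b ->
  {within `[a, b], continuous f} ->
  (forall x, a < x < b -> is_derive x 1 f (df x)) ->
  (forall x, a < x < b -> df x <= 0) -> f b <= f a.
Proof.
move=> ab fc fd df0.
apply: (@ler0_derive1_le_cc _ f a b) => //; rewrite ?in_itv/= ?lexx ?ab//.
- by move=> x; rewrite in_itv/= => /fd h; exact: ex_derive.
- move=> x; rewrite in_itv/= => xab; have h := fd _ xab.
  by rewrite derive1E derive_val df0.
Qed.

Lemma continuous_primitive (g : R -> R) (a : R) : continuous g ->
  exists G : R -> R, forall t, a < t -> is_derive t 1 G (g t).
Proof.
move=> gc.
exists (fun y => \int[lebesgue_measure]_(t in `[a, y]) g t)%R => t at_.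
have [||||dG G1] := @continuous_FTC1 R g (BLeft a) t (t + 1) _ _ _ _.
- by rewrite ltrDl.
- apply: continuous_compact_integrable; first exact: segment_compact.
  exact: continuous_subspaceT.
- by [].
- exact: gc.
apply: DeriveDef; first exact: dG.
by rewrite -derive1E; exact: G1.
Qed.

Lemma is_derive_continuous (f : R -> R) (t d : R) :
  is_derive t 1 f d -> {for t, continuous f}.
Proof.
move=> h; apply: differentiable_continuous; apply/derivable1_diffP.
exact: ex_derive.
Qed.

(** Freezing [g] to the left of [a] makes it continuous on the whole line, as
    the existence of a primitive requires. *)
Lemma within_continuous_clamp (g : R -> R) (a : R) :
  {within `[a, +oo[, continuous g} -> continuous (fun s => g (Num.max s a)).
Proof.
move=> /subspace_continuousP gc s.
have sa : `[a, +oo[%classic (Num.max s a).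
  by rewrite /= in_itv/= andbT le_max lexx orbT.
apply: cvg_trans (gc _ sa) => U /=; rewrite nbhs_simpl/= => HU.
have mc : {for s, continuous (fun s => Num.max s a)}.
  apply: (@continuous_max _ _ id (cst a)); [exact: cvg_id|exact: cvg_cst].
have := mc _ HU; rewrite nbhs_simpl/=; apply: filterS => y; apply.
by rewrite /= in_itv/= andbT le_max lexx orbT.
Qed.

(** The shape of the functional in [delay_gronwall]: [E] is the exponential
    weight, the increment of the primitive [G] over a delay interval pays for
    the delayed term, and [d * E s] for the constant forcing. *)
Lemma is_derive_krasovskii (E V G : R -> R) (c d T s dE dV k k' : R) :
  is_derive s 1 E dE -> is_derive s 1 V dV ->
  is_derive s 1 G k -> is_derive (s - T) 1 G k' ->
  is_derive s 1 (fun s => E s * V s + c * (G s - G (s - T)) - d * E s)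
    (E s * dV + V s * dE + c * (k - k') - d * dE).
Proof.
move=> dEs dVs dGs dGT.
have dGsh : is_derive s 1 (G \o shift (- T)) (k' * 1).
  by apply: is_derive1_comp; exact: is_derive_shift.
rewrite -[k' in k - k']mulr1.
exact: (is_deriveB (is_deriveD (is_deriveM dEs dVs)
          (is_deriveZ c (is_deriveB dGs dGsh))) (is_deriveZ d dEs)).
Qed.

Lemma within_continuous_krasovskii (A : set R) (E V G : R -> R) (c d T : R) :
  {within A, continuous E} -> {within A, continuous V} ->
  {within A, continuous G} -> {within A, continuous (G \o shift (- T))} ->
  {within A, continuous (fun s => E s * V s + c * (G s - G (s - T)) - d * E s)}.
Proof.
move=> Ec Vc Gc GTc.
have EV : {within A, continuous (E * V)}.
  by move=> s; apply: continuousM; [exact: Ec|exact: Vc].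
have cG : {within A, continuous (c \*: (G - (G \o shift (- T))))}.
  by move=> s; apply: continuousZr; exact: (within_continuousB Gc GTc).
have ME : {within A, continuous (d \*: E)}.
  by move=> s; apply: continuousZr; exact: Ec.
exact: within_continuousB (within_continuousD EV cG) ME.
Qed.

(** The weighted functional
    [expR (l * t) * V t + c * (G t - G (t - T)) - M / l * expR (l * t)],
    with [G] a primitive of [expR (l * s) * g s], is nonincreasing as soon as
    [l * p + c <= a] (damping of [g t]) and [expR (l * T) <= c] (compensation of
    [g (t - T)]).  Both hold for some [l > 0] and [c > 1] since [1 < a]; the
    constants depend on [a], [p] and [T] only, which makes the estimate uniform
    in the solution. *)
Lemma delay_gronwall (a p T : R) : 1 < a -> 0 <= p -> 0 < T ->
  exists l C : R, [/\ 0 < l, 0 < C & forall (V dV g : R -> R) (M S : R),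
    {within `[- T, +oo[, continuous g} ->
    {within `[0, +oo[, continuous V} ->
    (forall t : R, 0 < t -> is_derive t 1 V (dV t)) ->
    (forall t : R, - T <= t -> 0 <= g t) ->
    (forall t : R, - T <= t <= 0 -> g t <= S) ->
    (forall t : R, 0 <= t -> V t <= p * g t) ->
    (forall t : R, 0 < t -> dV t <= - a * g t + g (t - T) + M) ->
    0 <= M ->
    forall t : R, 0 <= t -> V t <= M / l + C * S * expR (- l * t)].
Proof.
move=> a1 p0 T0.
(* Half of the gap [a - 1] goes to [c], the other half to [l * p]. *)
pose c := (1 + a) / 2.
have c1 : 1 < c by rewrite /c; lra.
pose l := Num.min (ln c / T) ((a - 1) / (2 * (p + 1))).
have l0 : 0 < l.
  have p1 : 0 < p + 1 by rewrite ltr_wpDl.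
  by rewrite /l lt_min !divr_gt0 ?ln_gt0 ?mulr_gt0 ?subr_gt0.
have lp : l * p + c <= a.
  have : l <= (a - 1) / (2 * (p + 1)) by rewrite /l ge_min lexx orbT.
  rewrite ler_pdivlMr; last by rewrite mulr_gt0 // ltr_wpDl.
  rewrite /c; nra.
have lT : 1 <= c * expR (- l * T).
  have : l * T <= ln c by rewrite -ler_pdivlMr // /l ge_min lexx.
  rewrite -ler_expR lnK ?posrE; last by lra.
  move=> h; rewrite mulNr expRN -ler_pdivrMr ?invr_gt0 ?expR_gt0 // invrK mul1r.
  exact: h.
exists l; exists (p + c * T); split; first exact: l0.
  by rewrite ltr_wpDl // mulr_gt0 //; lra.
move=> V dV g M S gc Vc Vd g0 gS Vg dVle M0 t t0.
pose E := fun s : R => expR (l * s).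
have Ed (s : R) : is_derive s 1 E (l * E s).
  have -> : l * E s = expR (l * s) * (l *: 1) by rewrite /E mulrC [l *: 1]mulr1.
  exact: (is_derive1_comp (is_derive_expR _) (is_deriveZ l (is_derive_id s _))).
have Epos s : 0 < E s by exact: expR_gt0.
pose k s := E s * g (Num.max s (- T)).
have kE s : - T <= s -> k s = E s * g s by move=> Ts; rewrite /k max_l.
have kc : continuous k.
  move=> s; apply: continuousM; last exact: within_continuous_clamp.
  exact: (is_derive_continuous (Ed s)).
(* The base point is left of [- T], so that [G] is differentiable at [- T]. *)
have [G Gd] := continuous_primitive (- T - 1) kc.
have Gcont s : - T - 1 < s -> {for s, continuous G}.
  by move=> /Gd /is_derive_continuous.
have Gmono : G (t - T) <= G t.
  rewrite -lerN2; apply: (@derive_le0_le (- G) (fun s => - k s)).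
  - by rewrite gerBl ltW.
  - apply: continuous_in_subspaceT => s; rewrite inE/= in_itv/= => /andP[h _].
    by apply: continuousN; apply: Gcont; lra.
  - by move=> s /andP[h _]; apply: is_deriveN; apply: Gd; lra.
  move=> s /andP[h _]; rewrite oppr_le0 kE; last by lra.
  by rewrite mulr_ge0 ?g0 // ?ltW //; lra.
have G0 : G 0 - G (- T) <= S * T.
  have : (G - S \*: id) 0 <= (G - S \*: id) (- T).
    apply: (@derive_le0_le _ (fun s => k s - S *: 1)).
    - by rewrite oppr_le0 ltW.
    - apply: continuous_in_subspaceT => s; rewrite inE/= in_itv/= => /andP[h _].
      apply: is_derive_continuous; apply: is_deriveB; apply: Gd; lra.
    - move=> s /andP[h _]; apply: is_deriveB; apply: Gd; lra.
    move=> s /andP[h1 h2]; rewrite [S *: 1]mulr1 (kE _ (ltW h1)) subr_le0.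
    have gs : 0 <= g s <= S by rewrite g0 ?gS ?ltW.
    have : E s <= 1 by rewrite /E expR_le1 pmulr_rle0 // ltW.
    have := Epos s; nra.
  have -> : (G - S \*: id) 0 = G 0 - S * 0 by [].
  have -> : (G - S \*: id) (- T) = G (- T) - S * (- T) by [].
  lra.
pose W (s : R) : R := E s * V s + c * (G s - G (s - T)) - M / l * E s.
pose dW (s : R) : R := E s * dV s + V s * (l * E s) + c * (k s - k (s - T))
             - M / l * (l * E s).
have Wc : {within `[0, t], continuous W}.
  apply: within_continuous_krasovskii.
  - by apply: continuous_subspaceT => s; apply: is_derive_continuous (Ed s).
  - by apply: continuous_subspaceW Vc; apply: subset_itvl; rewrite bnd_simp.
  - apply: continuous_in_subspaceT => s; rewrite inE/= in_itv/= => /andP[s0 st].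
    by apply: Gcont; lra.
  - apply: continuous_in_subspaceT => s; rewrite inE/= in_itv/= => /andP[s0 st].
    apply: continuous_comp; last by apply: Gcont; rewrite /=; lra.
    exact: is_derive_continuous (is_derive_shift _ _ _).
have Wd s : 0 < s < t -> is_derive s 1 W (dW s).
  move=> /andP[s0 _].
  have s1 : - T - 1 < s by lra.
  have s2 : - T - 1 < s - T by lra.
  exact: (is_derive_krasovskii c (M / l) (Ed s) (Vd s s0) (Gd s s1) (Gd _ s2)).
have dW0 s : 0 < s < t -> dW s <= 0.
  move=> /andP[s0 st]; rewrite /dW.
  rewrite kE; last by lra.
  rewrite kE; last by lra.
  have -> : E (s - T) = E s * expR (- l * T).
    by rewrite /E -expRD; congr expR; ring.
  have -> : M / l * (l * E s) = E s * M by field; rewrite gt_eqF.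
  suff : dV s + l * V s + c * g s - c * expR (- l * T) * g (s - T) - M <= 0.
    move=> h; have := mulr_ge0_le0 (ltW (Epos s)) h.
    by congr (_ <= _); ring.
  have := dVle s s0.
  have : l * V s <= l * (p * g s) by rewrite ler_wpM2l ?Vg ?ltW.
  have : (l * p + c) * g s <= a * g s by rewrite ler_wpM2r ?g0 //; lra.
  have : 1 * g (s - T) <= c * expR (- l * T) * g (s - T).
    by rewrite ler_wpM2r ?g0 //; lra.
  move: (g (s - T)) (c * expR _) => gT ce; lra.
have := derive_le0_le t0 Wc Wd dW0.
have E0 : E 0 = 1 by rewrite /E mulr0 expR0.
rewrite /W E0 sub0r !mul1r mulr1 => Wle.
have Et : expR (- l * t) = (E t)^-1 by rewrite mulNr expRN.
have S0 : 0 <= S.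
  have := g0 0; have := gS 0; rewrite lexx oppr_le0 ltW // => /(_ isT) + /(_ isT).
  exact: (fun x y => le_trans y x).
have V0 : V 0 <= p * S.
  apply: le_trans (Vg 0 (lexx _)) _; rewrite ler_wpM2l // gS //.
  by rewrite lexx oppr_le0 ltW.
have Ml : 0 <= M / l by rewrite divr_ge0 // ltW.
rewrite -(ler_pM2l (Epos t)) mulrDr Et.
rewrite [X in _ <= _ + X]mulrC divfK ?gt_eqF //.
nra.
Qed.

End Delay.

(** * The rescaled observation error *)

Section Observer.
Context {R : realType}.

(** The high-gain rescaling by the diagonal matrix of
    [1, eps, ..., eps ^+ n.-1]. *)
Definition weight n (eps : R) (v : 'cV[R]_n) : 'cV[R]_n :=
  \col_i (eps ^+ i * v i 0).

Lemma weightD n eps (v w : 'cV[R]_n) :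
  weight eps (v + w) = weight eps v + weight eps w.
Proof. by apply/matrixP => i j; rewrite !mxE mulrDr. Qed.

(** Consecutive weights differ by a factor [eps], which the superdiagonal of
    [shiftA] turns into [eps^-1]; the powers of [eps] in [gainL] are chosen so
    that the correction term scales in the same way. *)
Lemma weight_observer n eps (L e : 'cV[R]_n) : 0 < eps ->
  weight eps (shiftA R n *m e + gainL L eps *m (outC R n *m e))
    = eps^-1 *: ((shiftA R n + L *m outC R n) *m weight eps e).
Proof.
move=> eps0; rewrite mulmxA -mulmxDl.
apply/matrixP => i j; rewrite ord1 !mxE !mulr_sumr.
apply: eq_bigr => k _; rewrite !mxE !big_ord1 !mxE.
rewrite (ord1 ord0).
have aE : (i.+1 == k)%:R * eps ^+ k = (i.+1 == k)%:R * (eps * eps ^+ i).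
  by have [<-|_] := eqVneq i.+1 k; rewrite ?mul0r // exprS.
have bE : (k == 0%N :> nat)%:R * eps ^+ k = (k == 0%N :> nat)%:R.
  by have [->|_] := eqVneq (k : nat) 0%N; rewrite ?mul0r // expr0 mulr1.
rewrite [X in _ = _ * X]mulrA [X in _ = _ * (X * _)]mulrDl aE.
rewrite -[X in _ = _ * ((_ + X) * _)]mulrA bE exprS.
by field; rewrite ?expf_neq0 gt_eqF.
Qed.

Lemma is_derive_weighted_error n eps (L gh g : 'cV[R]_n)
    (xh x : R -> 'cV[R]_n) (s : R) i : 0 < eps -> 0 < s ->
  is_derive_within `[0, +oo[ xh s
    (shiftA R n *m xh s + gh
     + gainL L eps *m (outC R n *m xh s - outC R n *m x s)) ->
  is_derive_within `[0, +oo[ x s (shiftA R n *m x s + g) ->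
  is_derive s (1 : R) (fun r => weight eps (xh r - x r) i 0)
    ((eps^-1 *: ((shiftA R n + L *m outC R n) *m weight eps (xh s - x s))
      + weight eps (gh - g)) i 0).
Proof.
move=> eps0 s0 /(is_derive_within_coord i s0) dxh.
move=> /(is_derive_within_coord i s0) dx.
have -> : (fun r : R => weight eps (xh r - x r) i 0) =
    (fun r : R => eps ^+ i * (xh r i 0 - x r i 0)).
  by apply/funext => r; rewrite !mxE.
apply: is_derive_eq (is_deriveZ _ (is_deriveB dxh dx)) _.
rewrite -weight_observer // -weightD [RHS]mxE; congr (_ * _).
rewrite !mulmxBr.
move: (shiftA R n *m xh s) (shiftA R n *m x s) => Axh Ax.
move: (gainL L eps *m _) (gainL L eps *m _) => Lxh Lx.
by rewrite !mxE; ring.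
Qed.

Lemma weightK n eps (v : 'cV[R]_n) : 0 < eps ->
  weight eps^-1 (weight eps v) = v.
Proof.
move=> eps0; apply/matrixP => i j; rewrite !mxE ord1 mulrA -exprMn.
by rewrite mulVf ?gt_eqF // expr1n mul1r.
Qed.

Lemma enorm_weight n eps : 0 < eps ->
  exists2 k, 0 < k & forall v : 'cV[R]_n, enorm (weight eps v) <= k * enorm v.
Proof.
move=> eps0; exists (1 + \sum_(i < n) eps ^+ i).
  by rewrite ltr_pwDl // sumr_ge0 // => i _; rewrite exprn_ge0 // ltW.
move=> v; apply: le_trans (enorm_le_sum_coord _) _.
rewrite mulrDl mul1r mulr_suml ler_wpDl ?enorm_ge0 //.
apply: ler_sum => i _; rewrite mxE normrM ger0_norm ?exprn_ge0 ?(ltW eps0) //.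
by rewrite ler_wpM2l ?coord_le_enorm // exprn_ge0 // ltW.
Qed.

Lemma sum_weight_le_enorm n eps (v : 'cV[R]_n) : 0 < eps ->
  \sum_(i < n) eps ^+ i * `|v i 0| <= n%:R * enorm (weight eps v).
Proof.
move=> eps0; apply: le_trans (sum_coord_le_enorm _).
apply: ler_sum => i _; rewrite mxE normrM ger0_norm ?exprn_ge0 ?(ltW eps0) //.
Qed.

Lemma enorm_weight_le_sum n eps (v : 'cV[R]_n) : 0 < eps ->
  enorm (weight eps v) <= \sum_(i < n) eps ^+ i * `|v i 0|.
Proof.
move=> eps0; apply: le_trans (enorm_le_sum_coord _) _.
apply: ler_sum => i _; rewrite mxE normrM ger0_norm ?exprn_ge0 ?(ltW eps0) //.
Qed.

Lemma lyapunov_form n (M P : 'M[R]_n) (z h : 'cV[R]_n) (d : R) :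
  P^T = P -> M^T *m P + P *m M = - 1%:M ->
  let w := d *: (M *m z) + h in
  dot w (P *m z) + dot z (P *m w) = - d * enorm z ^+ 2 + 2 * dot z (P *m h).
Proof.
move=> Psym lyap w.
have lyap' : dot (M *m z) (P *m z) + dot z (P *m (M *m z)) = - enorm z ^+ 2.
  rewrite -{1}[M]trmxK -dot_mulmxr !mulmxA -dotDr -mulmxDl lyap.
  by rewrite mulNmx mul1mx enorm_sqr /dot mulmxN mxE.
have hP : dot h (P *m z) = dot z (P *m h) by rewrite dot_mulmxr Psym dotC.
rewrite /w mulmxDr -scalemxAr !dotDl !dotDr dotZl dotZr hP.
have -> : dot (M *m z) (P *m z) = - enorm z ^+ 2 - dot z (P *m (M *m z)).
  by rewrite -lyap' addrK.
ring.
Qed.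

(** Young's inequality for the delayed product, with all of [r ^+ 2] on one
    side, and for the constant forcing [M0], at the price of [1 / 4]. *)
Lemma young_bound (d p N g1 g2 M0 q r : R) :
  - d * q ^+ 2 + 2 * (q * (p * (g1 * (N * q) + g2 * (N * r) + M0)))
  <= - (d - 2 * N * g1 * p - 1 / 4 - N ^+ 2 * g2 ^+ 2 * p ^+ 2) * q ^+ 2
     + r ^+ 2 + 4 * p ^+ 2 * M0 ^+ 2.
Proof.
have := sqr_ge0 (N * g2 * p * q - r).
have := sqr_ge0 (q / 2 - 2 * p * M0).
lra.
Qed.

(** Together with this bound the gain condition becomes the requirement that
    the factor of [q ^+ 2] in [young_bound], for [d = eps^-1], exceeds 1. *)
Lemma gain_quotient_le n (P : 'M[R]_n) (eps : R) : 0 < eps -> P^T = P ->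
  lambda_min P / (eps * opnorm P) <= eps^-1.
Proof.
move=> eps0 Psym; have [->|p0] := eqVneq (opnorm P) 0.
  by rewrite mulr0 invr0 mulr0 invr_ge0 ltW.
have pp : 0 < opnorm P by rewrite lt_neqAle eq_sym p0 opnorm_ge0.
rewrite ler_pdivrMr ?mulr_gt0 // mulrA mulVf ?gt_eqF // mul1r.
exact: lambda_min_le_opnorm.
Qed.

(** Here [T] marks values at the known delay and [d] values at the true one.
    Going through [f x xT v vT], the first inequality of [assumption_A1] bounds
    the part due to the estimation error, and the second one the part due to
    the mismatch of the delays, which boundedness of state and input keeps
    under a constant. *)
Lemma nonlinearity_bound n m
    (f : 'cV[R]_n -> 'cV[R]_n -> 'cV[R]_m -> 'cV[R]_m -> 'cV[R]_n)
    (g1 g2 g3 : R -> R) (eps B Bu : R)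
    (y x yT xT xd : 'cV[R]_n) (v vT vd : 'cV[R]_m) :
  assumption_A1 f g1 g2 g3 -> 0 < eps ->
  (forall i, `|xT i 0| <= B) -> (forall i, `|xd i 0| <= B) ->
  enorm vT <= Bu -> enorm vd <= Bu ->
  enorm (weight eps (f y yT v vT - f x xd v vd)) <=
    g1 eps * (n%:R * enorm (weight eps (y - x)))
    + g2 eps * (n%:R * enorm (weight eps (yT - xT)))
    + (g2 eps * (\sum_(i < n) eps ^+ i * (B + B))
       + g3 eps * (\sum_(i < n) eps ^+ i * (Bu + Bu))).
Proof.
move=> A1 eps0 xTB xdB vTB vdB.
have [[g1p g2p g3p] lip] := A1 eps eps0.
have [lip1 _] := lip y x yT xT v vT 0.
have [_ lip2] := lip x x xT xd v vT vd.
have -> : f y yT v vT - f x xd v vd =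
    (f y yT v vT - f x xT v vT) + (f x xT v vT - f x xd v vd) by rewrite subrKA.
rewrite weightD.
apply: le_trans (enormD _ _) _; apply: lerD.
  apply: le_trans (enorm_weight_le_sum _ eps0) _.
  have H (a b : 'cV[R]_n) : \sum_(i < n) eps ^+ i * `|(a - b) i 0|
      = \sum_(i < n) eps ^+ i * `|a i 0 - b i 0|.
    by apply: eq_bigr => i _; rewrite !mxE.
  rewrite H; apply: le_trans lip1 _; rewrite -!H; apply: lerD; rewrite ler_pM2l //.
  - exact: sum_weight_le_enorm.
  - exact: sum_weight_le_enorm.
apply: le_trans (enorm_weight_le_sum _ eps0) _.
under eq_bigr do rewrite mxE [(- f _ _ _ _) _ _]mxE.
apply: le_trans lip2 _; apply: lerD; rewrite ler_pM2l //; apply: ler_sum => i _;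
  rewrite ler_wpM2l ?exprn_ge0 ?(ltW eps0) //.
- by apply: le_trans (ler_normB _ _) _; rewrite lerD.
- by apply: le_trans (enormD _ _) _; rewrite enormN lerD.
Qed.

Lemma le_sqrtD_of_sqr_le (c q A b : R) : 0 < c -> 0 <= A -> 0 <= b -> 0 <= q ->
  c * q ^+ 2 <= A + b ^+ 2 -> q <= Num.sqrt (A / c) + b / Num.sqrt c.
Proof.
move=> c0 A0 b0 q0 h.
have Ac : 0 <= A / c by rewrite divr_ge0 // ltW.
have sc : 0 < Num.sqrt c by rewrite sqrtr_gt0.
have bc : 0 <= b / Num.sqrt c by rewrite divr_ge0 // ltW.
rewrite -ler_sqr ?qualifE /= ?addr_ge0 ?sqrtr_ge0 //.
rewrite sqrrD sqr_sqrtr // expr_div_n sqr_sqrtr ?(ltW c0) //.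
have : q ^+ 2 <= A / c + b ^+ 2 / c by rewrite -mulrDl ler_pdivlMr // mulrC.
have : 0 <= Num.sqrt (A / c) * (b / Num.sqrt c) by rewrite mulr_ge0 ?sqrtr_ge0.
by lra.
Qed.

End Observer.

(** * Practical exponential stability *)

Theorem theorem2 (R : realType) (n m : nat) (n_gt0 : (0 < n)%N)
  (f : 'cV[R]_n -> 'cV[R]_n -> 'cV[R]_m -> 'cV[R]_m -> 'cV[R]_n)
  (f_smooth : forall i : 'I_n,
    smooth (fun z : 'cV[R]_n * 'cV[R]_n * 'cV[R]_m * 'cV[R]_m =>
              f z.1.1.1 z.1.1.2 z.1.2 z.2 i 0))
  (f0 : f 0 0 0 0 = 0)
  (gamma1 gamma2 gamma3 : R -> R)
  (hA1 : assumption_A1 f gamma1 gamma2 gamma3)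
  (taus : R) (tau : R -> R) (hH2 : assumption_H2 taus tau)
  (K : set 'cV[R]_n) (K_compact : compact K)
  (u : R -> 'cV[R]_m)
  (u_continuous : {within `[- taus, +oo[, continuous u})
  (u_bounded : [bounded u t | t in `[- taus, +oo[])
  (L : 'cV[R]_n) (hL : hurwitz (shiftA R n + L *m outC R n))
  (P : 'M[R]_n) (P_posdef : sym_posdef P)
  (P_lyap : (shiftA R n + L *m outC R n)^T *m P
            + P *m (shiftA R n + L *m outC R n) = - 1%:M)
  (eps : R) (eps_gt0 : 0 < eps)
  (heps : lambda_min P / (eps * opnorm P)
          - 2 * n%:R * gamma1 eps * opnorm P - 5 / 4
          - n%:R ^+ 2 * gamma2 eps ^+ 2 * opnorm P ^+ 2 > 0) :
  exists r lambda1 lambda2 : R,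
    [/\ 0 < r, 0 < lambda1, 0 < lambda2 &
     forall x xhat : R -> 'cV[R]_n,
       system_solution f taus tau u x ->
       (forall t, - taus <= t -> K (x t)) ->
       observer_solution f taus (gainL L eps) u (fun t => outC R n *m x t)
         xhat ->
       forall t, 0 <= t ->
         enorm (xhat t - x t)
           <= r + lambda1
                  * sup [set enorm (xhat s - x s) | s in `[- taus, 0]]
                  * expR (- lambda2 * t)].
Proof.
have [T0 tauT _] := hH2.
have [Psym _] := P_posdef.
have [B KB] := bounded_coord (F := id) (compact_bounded K_compact).
have [b ub] := bounded_coord u_bounded.
pose Bu := \sum_(i < m) b.
have uB (s : R) : - taus <= s -> enorm (u s) <= Bu.
  move=> sT; apply: le_trans (enorm_le_sum_coord _) _.
  by apply: ler_sum => i _; apply: ub; rewrite /= in_itv/= andbT.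
have [[g1p g2p g3p] _] := hA1 eps eps_gt0.
pose p := opnorm P; have p0 : 0 <= p := opnorm_ge0 P.
pose a := eps^-1 - 2 * n%:R * gamma1 eps * p - 1 / 4
          - n%:R ^+ 2 * gamma2 eps ^+ 2 * p ^+ 2.
have a1 : 1 < a.
  by have := gain_quotient_le eps_gt0 Psym; move: heps; rewrite /a /p; lra.
have [l [C [l0 C0 gron]]] := delay_gronwall a1 p0 T0.
have [c c0 coer] := posdef_coercive P_posdef.
have [k1 k1p weightVle] : exists2 k, 0 < k &
    forall v : 'cV[R]_n, enorm (weight eps^-1 v) <= k * enorm v.
  by apply: enorm_weight; rewrite invr_gt0.
have [k2 k2p weight_le] := @enorm_weight R n eps eps_gt0.
pose M0 := gamma2 eps * (\sum_(i < n) eps ^+ i * (B + B))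
           + gamma3 eps * (\sum_(i < n) eps ^+ i * (Bu + Bu)).
pose M := 4 * p ^+ 2 * M0 ^+ 2.
have M_ge0 : 0 <= M by apply: mulr_ge0 (sqr_ge0 _); apply: mulr_ge0 (sqr_ge0 _).
have Ml : 0 <= M / l by rewrite divr_ge0 // ltW.
have sc : 0 < Num.sqrt c by rewrite sqrtr_gt0.
have sC : 0 < Num.sqrt C by rewrite sqrtr_gt0.
(* The rate is halved because [V] is quadratic in the error; adding 1 keeps the
   radius positive when [M] vanishes. *)
exists (k1 * (Num.sqrt (M / l / c) + 1)).
exists (k1 * (Num.sqrt C * k2 / Num.sqrt c)), (l / 2); split.
- by rewrite mulr_gt0 // ltr_wpDl ?sqrtr_ge0.
- by rewrite !mulr_gt0 ?invr_gt0.
- by rewrite divr_gt0.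
move=> x xhat [xc xd] Kx [xhc xhd] t t0.
pose z (s : R) := weight eps (xhat s - x s).
pose h (s : R) := weight eps (f (xhat s) (xhat (s - taus)) (u s) (u (s - taus))
                        - f (x s) (x (s - tau s)) (u s) (u (s - tau s))).
pose w (s : R) := eps^-1 *: ((shiftA R n + L *m outC R n) *m z s) + h s.
have zd (s : R) i : 0 < s -> is_derive s (1 : R) (fun r => z r i 0) (w s i 0).
  move=> s0.
  rewrite /z /w /h; apply: is_derive_weighted_error => //.
  - exact: xhd (ltW s0).
  - exact: xd (ltW s0).
have zc i : {within `[- taus, +oo[, continuous (fun s => z s i 0)}.
  have -> : (fun s : R => z s i 0) =
      eps ^+ i \*: (fun s : R => (xhat s - x s) i 0).
    by apply/funext => s; rewrite mxE.
  move=> s; apply: continuousZr.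
  exact: (within_continuous_coordB (i := i) xhc xc).
set Se := sup _.
have Se_ub (s : R) : - taus <= s <= 0 -> enorm (xhat s - x s) <= Se.
  apply: (@enorm_le_sup_segment _ _ (fun r => xhat r - x r)) => i.
  apply: (@continuous_subspaceW _ _ _ `[- taus, +oo[%classic).
    exact: subset_itvl.
  exact: within_continuous_coordB.
have Se0 : 0 <= Se.
  apply: le_trans (enorm_ge0 _) (Se_ub 0 _).
  by rewrite lexx oppr_le0 ltW.
pose V (s : R) := dot (z s) (P *m z s).
have Vle : V t <= M / l + C * (k2 * Se) ^+ 2 * expR (- l * t).
  apply: (gron V (fun s => dot (w s) (P *m z s) + dot (z s) (P *m w s))
             (fun s => enorm (z s) ^+ 2)) => //.
  - have -> : (fun s : R => enorm (z s) ^+ 2) = (fun s => dot (z s) (z s)).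
      by apply/funext => s; exact: enorm_sqr.
    exact: within_continuous_dot.
  - have zc0 i : {within `[0, +oo[, continuous (fun s => z s i 0)}.
      apply: continuous_subspaceW (zc i); apply: subset_itvr.
      by rewrite bnd_simp oppr_le0 ltW.
    apply: within_continuous_dot => // i; exact: within_continuous_mulmx.
  - by move=> s s0; apply: is_derive_quadratic => i; exact: zd.
  - by move=> s _; exact: sqr_ge0.
  - move=> s sT; rewrite ler_sqr ?qualifE /= ?enorm_ge0 ?mulr_ge0 ?(ltW k2p) //.
    by apply: le_trans (weight_le _) _; rewrite ler_pM2l // Se_ub.
  - move=> s _; apply: le_trans (dot_le_enorm _ _) _.
    rewrite expr2 mulrCA ler_wpM2l ?enorm_ge0 //; exact: enorm_le_opnorm.
  move=> s s0; have /andP[tau0 tau1] := tauT s (ltW s0).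
  rewrite (lyapunov_form _ _ _ Psym P_lyap).
  apply: le_trans (young_bound _ _ n%:R (gamma1 eps) (gamma2 eps) M0 _ _).
  rewrite lerD2l ler_pM2l //.
  apply: le_trans (dot_le_enorm _ _) _; rewrite ler_wpM2l ?enorm_ge0 //.
  apply: le_trans (enorm_le_opnorm _ _) _; rewrite ler_wpM2l //.
  apply: nonlinearity_bound => //.
  - by apply: KB; apply: Kx; lra.
  - by apply: KB; apply: Kx; lra.
  - by apply: uB; lra.
  - by apply: uB; lra.
have Ehalf : expR (- (l / 2) * t) ^+ 2 = expR (- l * t).
  by rewrite -expRM_natl; congr expR; field.
pose be := Num.sqrt C * (k2 * Se) * expR (- (l / 2) * t).
have zle : enorm (z t) <= Num.sqrt (M / l / c) + be / Num.sqrt c.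
  apply: le_sqrtD_of_sqr_le => //.
  - by rewrite /be !mulr_ge0 ?sqrtr_ge0 ?expR_ge0 // ltW.
  - exact: enorm_ge0.
  apply: le_trans (coer _) _; rewrite /be exprMn Ehalf exprMn sqr_sqrtr ?(ltW C0) //.
rewrite -[xhat t - x t](weightK _ eps_gt0).
apply: le_trans (weightVle _) _.
apply: le_trans (ler_wpM2l (ltW k1p) zle) _.
rewrite -subr_ge0 (_ : _ - _ = k1); first exact: ltW.
rewrite /be; field.
by rewrite gt_eqF.
Qed.
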